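(* Let $\mathbb{K}$ be a field, $R=\mathbb{K}[x_1,\dots,x_d]$, and let $I$ be a squarefree monomial ideal of $R$. Then there exists a positive integer $g$ such that the rational powers of $I^{(g)}$ are the symbolic powers of $I$; that is, $I^{(n)}=(I^{(g)})^{\frac{n}{g}}$ for every $n\in\mathbb{N}$.
   Context: Symbolic powers: $I^{(n)}=\bigcap_{\mathfrak{p}\in\mathrm{Min}(I)}(I^nR_{\mathfrak{p}}\cap R)$, where $\mathrm{Min}(I)$ is the set of minimal primes of $I$. Rational powers: for an ideal $I$ of a commutative ring $A$ and $\frac{a}{b}\in\mathbb{Q}_+$ with $a,b$ positive integers, $I^{\frac{a}{b}}=\{x\in A \mid x^b\in\overline{I^a}\}$, where $\overline{\phantom{I}}$ denotes integral closure of ideals; this is an ideal depending only on the rational number $\frac{a}{b}$. For exponent $0$ both the rational power and the symbolic power are $R$. *)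

(* Defs.v *)
From HB Require Import structures.
From mathcomp Require Import all_boot all_algebra.
From mathcomp Require Import mpoly.

Set Implicit Arguments.
Unset Strict Implicit.
Unset Printing Implicit Defensive.

Import GRing.Theory.
Local Open Scope ring_scope.

Local Notation "x %:F" := (FracField.tofrac x).

(* Ideals are Prop-valued predicates: the idealr structures of ring_quotient
   only cover decidable ideals, which is not enough to quantify over all
   prime ideals. *)

Definition subideal (A : comNzRingType) (I J : A -> Prop) : Prop :=
  forall x, I x -> J x.

Definition is_ideal (A : comNzRingType) (I : A -> Prop) : Prop :=
  [/\ I 0, forall x y, I x -> I y -> I (x + y)
    & forall a x, I x -> I (a * x)].

Definition is_prime_ideal (A : comNzRingType) (P : A -> Prop) : Prop :=
  [/\ is_ideal P, ~ P 1 & forall x y, P (x * y) -> P x \/ P y].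

(* Finite linear combinations of elements of S with coefficients in C. *)
Definition lin_span (A : comNzRingType) (C S : A -> Prop) : A -> Prop :=
  fun x => exists k (c s : 'I_k -> A),
    [/\ forall i, C (c i), forall i, S (s i) & x = \sum_(i < k) c i * s i].

Definition ideal_gen (A : comNzRingType) (S : A -> Prop) : A -> Prop :=
  lin_span (fun=> True) S.

(* For n = 0 the generator is the empty product, so the power is A. *)
Definition ideal_pow (A : comNzRingType) (I : A -> Prop) (n : nat) :
    A -> Prop :=
  ideal_gen (fun x => exists2 y : 'I_n -> A,
    forall i, I (y i) & x = \prod_(i < n) y i).

Definition minimal_prime (A : comNzRingType) (I P : A -> Prop) : Prop :=
  [/\ is_prime_ideal P, subideal I P
    & forall Q, is_prime_ideal Q -> subideal I Q -> subideal Q P ->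
        subideal P Q].

(* A is a domain, so A_P is realized as a subring of its fraction field. *)
Definition localization (A : idomainType) (P : A -> Prop) :
    {fraction A} -> Prop :=
  fun z => exists a s : A, ~ P s /\ z = a%:F / s%:F.

Definition ideal_ext (A : idomainType) (P J : A -> Prop) :
    {fraction A} -> Prop :=
  lin_span (localization P) (fun z => exists2 y, J y & z = y%:F).

Definition symbolic_power (A : idomainType) (I : A -> Prop) (n : nat) :
    A -> Prop :=
  fun x => forall P, minimal_prime I P -> ideal_ext P (ideal_pow I n) x%:F.

Definition integral_closure (A : comNzRingType) (I : A -> Prop) : A -> Prop :=
  fun x => exists (m : nat) (a : nat -> A),
    [/\ (0 < m)%N,
        forall i, (1 <= i <= m)%N -> ideal_pow I i (a i)
      & x ^+ m + \sum_(1 <= i < m.+1) a i * x ^+ (m - i) = 0].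

(* The power of I with exponent a / b, for b > 0; for a = 0 this is A, since
   ideal_pow I 0 is A. *)
Definition rational_power (A : comNzRingType) (I : A -> Prop) (a b : nat) :
    A -> Prop :=
  fun x => integral_closure (ideal_pow I a) (x ^+ b).

Definition squarefree_monomial (d : nat) (m : 'X_{1..d}) : Prop :=
  forall i : 'I_d, (m i <= 1)%N.

(* The zero ideal (no generators) and the unit ideal (generator 'X_[0] = 1)
   are included. *)
Definition squarefree_monomial_ideal (K : fieldType) (d : nat)
    (I : {mpoly K[d]} -> Prop) : Prop :=
  exists2 S : 'X_{1..d} -> Prop,
    forall m, S m -> squarefree_monomial m
    & forall f, I f <-> ideal_gen (fun h => exists2 m, S m & h = 'X_[m]) f.

(* Main.v *)
Require Import Defs.
From mathcomp Require Import all_boot all_algebra.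
From mathcomp Require Import mpoly zify ring boolp.

(** Everything is read off the exponents of monomials.  Say that a set [C] of
    variables is a cover when every generating monomial of [I] involves a
    variable of [C], and let the [C]-order of a polynomial be the least total
    degree in the variables of [C] among its monomials.  The prime generated by
    the variables of [C] consists of the polynomials of positive [C]-order; the
    minimal primes of [I] are the ones obtained from the minimal covers, and the
    [n]-th symbolic power of [I] is the set of polynomials whose [C]-order is at
    least [n] for every cover [C] ([symbolic_powerP], [symbolic_power_ord_ge]).

    The [C]-order is a valuation ([has_ordM]), so its lower bounds survive
    integral closure: if [f ^+ g] is integral over the [n]-th power of the
    [g]-th symbolic power, then [g] times the [C]-order of [f] is at least
    [g * n].  This gives one inclusion, for every positive [g]
    ([ord_ge_integral]).

    For the other inclusion it is enough to find [g] such that the [g * n]-th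
    symbolic power is contained in the [n]-th ordinary power of the [g]-th one,
    because [f ^+ g] lies in the former as soon as [f] lies in the [n]-th
    symbolic power.  That containment concerns monomials only.  The pairs
    [(n, m)] such that the exponent [m] has degree at least [n] on every cover
    are the lattice points of a rational cone, so by Dickson's lemma finitely
    many of them generate the part that matters ([heavy_basis]).  Take a common
    multiple [L] of the degrees of the generators: as soon as [n] is large, some
    generator occurs often enough to fill a block of degree exactly [L], which
    can be split off.  With [g] a large enough multiple of [L], blocks of degree
    [g] split off until [n] of them are obtained ([heavy_veronese]). *)

Set Implicit Arguments.
Unset Strict Implicit.
Unset Printing Implicit Defensive.

Import GRing.Theory.

(** * Dickson's lemma and splitting of heavy exponents *)

(** The functions [fs] play the part of coordinates, and the points of [P] are
    bounded below by finitely many of them.  Induction on the number of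
    coordinates: let a finite set [s] bound [P] from below in all coordinates
    but the first one [f], and let [B] be the maximum of [f] on [s].  Then [s]
    also works in the coordinate [f] for the points where [f] is at least [B],
    and each of the slices where [f] is a constant less than [B] is handled by
    induction again. *)
Lemma dickson (X : eqType) (fs : seq (X -> nat)) (P : X -> Prop) :
  exists2 s : seq X, forall y, y \in s -> P y &
    forall x, P x -> exists2 y, y \in s & all (fun f => f y <= f x) fs.
Proof.
elim: fs P => [|f fs IHfs] P.
  have [[x Px]|noP] := pselect (exists x, P x).
    by exists [:: x] => [y /[!inE] /eqP-> //|z _]; exists x; rewrite ?mem_head.
  by exists [::] => // x Px; case: noP; exists x.
have [s Ps domP] := IHfs P.
pose B := \max_(y <- s) f y.
have [t Pt domPt] : exists2 t : seq X, forall y, y \in t -> P y &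
    forall x, P x -> f x < B ->
      exists2 y, y \in t & all (fun f => f y <= f x) (f :: fs).
  elim: B => [|b [t Pt domPt]]; first by exists [::].
  have [u Pu domPu] := IHfs (fun x => P x /\ f x = b).
  exists (t ++ u) => [y|x Px].
    by rewrite mem_cat => /orP[/Pt|/Pu[]].
  rewrite ltnS leq_eqVlt => /orP[/eqP fxb|/(domPt x Px)[y ty le_yx]].
    have [y uy le_yx] := domPu x (conj Px fxb).
    exists y; first by rewrite mem_cat uy orbT.
    by rewrite /= le_yx andbT; have [_ ->] := Pu y uy; rewrite fxb.
  by exists y; rewrite // mem_cat ty.
exists (s ++ t) => [y|x Px].
  by rewrite mem_cat => /orP[/Ps|/Pt].
have [Bx|/(domPt x Px)[y ty le_yx]] := leqP B (f x); last first.
  by exists y; rewrite // mem_cat ty orbT.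
have [y sy le_yx] := domP x Px.
exists y; first by rewrite mem_cat sy.
rewrite /= le_yx andbT (leq_trans _ Bx) //.
exact: (leq_bigmax_seq y).
Qed.

Definition wt (d : nat) (C : {set 'I_d}) (m : 'X_{1..d}) : nat :=
  \sum_(i in C) m i.

Lemma wtD (d : nat) (C : {set 'I_d}) (m1 m2 : 'X_{1..d}) :
  wt C (m1 + m2)%MM = wt C m1 + wt C m2.
Proof. by rewrite -big_split; apply: eq_bigr => i _; rewrite mnmDE. Qed.

Lemma wt0 (d : nat) (C : {set 'I_d}) : wt C 0%MM = 0.
Proof. by apply: big1 => i _; rewrite mnm0E. Qed.

Lemma wtMn (d : nat) (C : {set 'I_d}) (m : 'X_{1..d}) (q : nat) :
  wt C (m *+ q)%MM = wt C m * q.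
Proof.
by rewrite /wt big_distrl; apply: eq_bigr => i _; rewrite mulmnE.
Qed.

Lemma wtB (d : nat) (C : {set 'I_d}) (m1 m2 : 'X_{1..d}) :
  (m1 <= m2)%MM -> wt C (m2 - m1)%MM = wt C m2 - wt C m1.
Proof. by move=> le12; rewrite -{2}(submK le12) wtD addnK. Qed.

(** The lattice points of a cone; for [V] the covers of a squarefree monomial
    ideal these are the exponents of the monomials of its [n]-th symbolic
    power. *)
Definition heavy (d : nat) (V : {set 'I_d} -> Prop) (n : nat)
    (m : 'X_{1..d}) : Prop :=
  forall C, V C -> n <= wt C m.

(** A finite generating set, in the form of a reduction step: something can
    always be subtracted without leaving the cone.  Besides the coordinates of
    [(n, m)], Dickson's lemma is applied to the slacks [wt C m - n]; an
    inequality between slacks is exactly what makes the difference of two points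
    of the cone a point of the cone. *)
Lemma heavy_basis (d : nat) (V : {set 'I_d} -> Prop) :
  exists s : seq (nat * 'X_{1..d}),
    [/\ uniq s, forall y, y \in s -> 0 < y.1 /\ heavy V y.1 y.2 &
      forall n m, 0 < n -> heavy V n m -> exists2 y, y \in s &
        [/\ y.1 <= n, (y.2 <= m)%MM & heavy V (n - y.1) (m - y.2)%MM]].
Proof.
pose fs := (fun x : nat * 'X_{1..d} => x.1)
  :: [seq (fun x : nat * 'X_{1..d} => x.2 i) | i <- enum 'I_d]
  ++ [seq (fun x : nat * 'X_{1..d} => wt C x.2 - x.1) | C <- enum {set 'I_d}].
have [s Ps dom] := dickson fs (fun x => 0 < x.1 /\ heavy V x.1 x.2).
exists (undup s); split; first exact: undup_uniq.
  by move=> y; rewrite mem_undup; apply: Ps.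
move=> n m n_gt0 hm; have [y sy] := dom (n, m) (conj n_gt0 hm).
rewrite /= all_cat !all_map -!enumT => /and3P[le1 /allP le2 /allP le3].
have le_ym : (y.2 <= m)%MM.
  by apply/mnm_lepP => i; have := le2 i; rewrite mem_enum => /(_ isT).
exists y; first by rewrite mem_undup.
split=> // C VC; rewrite wtB //.
have /= := le3 C; rewrite mem_enum => /(_ isT); have := hm C VC.
have [_ /(_ C VC)] := Ps y sy; lia.
Qed.

(** Iterated subtraction of members of [s]; [k] counts the multiplicities.  A
    remainder of degree 0 is left over, hence only an inequality between
    exponents. *)
Lemma heavy_decomposition (d : nat) (V : {set 'I_d} -> Prop)
    (s : seq (nat * 'X_{1..d})) :
    uniq s -> (forall y, y \in s -> 0 < y.1) ->
    (forall n m, 0 < n -> heavy V n m -> exists2 y, y \in s &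
      [/\ y.1 <= n, (y.2 <= m)%MM & heavy V (n - y.1) (m - y.2)%MM]) ->
  forall n m, heavy V n m -> exists2 k : nat * 'X_{1..d} -> nat,
    n = \sum_(y <- s) k y * y.1 &
    forall i, \sum_(y <- s) k y * y.2 i <= m i.
Proof.
move=> us s_gt0 peel n; elim/ltn_ind: n => n IHn m hm.
have [->|n_gt0] := posnP n.
  by exists (fun=> 0) => [|i]; rewrite big1.
have [y sy [le_yn le_ym hB]] := peel n m n_gt0 hm.
have [|k Ek lek] := IHn _ _ _ hB; first by have := s_gt0 y sy; lia.
have addk F : \sum_(z <- s) (k z + (z == y)) * F z
    = \sum_(z <- s) k z * F z + F y.
  have -> : F y = \sum_(z <- s) (z == y) * F z.
    rewrite (bigD1_seq y) //= eqxx mul1n big1 ?addn0 // => z /negPf->.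
    by rewrite mul0n.
  by rewrite -big_split; apply: eq_bigr => z _; rewrite mulnDl.
exists (fun z => k z + (z == y)) => [|i].
  by rewrite addk -Ek subnK.
rewrite (addk (fun z => z.2 i)); move/mnm_lepP/(_ i): le_ym (lek i).
by rewrite mnmBE => le_i lek_i; rewrite -(subnK le_i) leq_add2r.
Qed.

(** [L] is a common multiple of the degrees of the generators and [r] their
    number: if every generator contributed less than [L], the total degree would
    be at most [r * L].  A generator contributing at least [L] provides the
    block, being repeated [L %/ y.1] times. *)
Lemma heavy_split_block (d : nat) (V : {set 'I_d} -> Prop) :
  exists L r : nat, 0 < L /\ forall n m, r * L < n -> heavy V n m ->
    exists b, [/\ (b <= m)%MM, heavy V L b & heavy V (n - L) (m - b)%MM].
Proof.
have [s [us Ps peel]] := heavy_basis V.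
have s_gt0 y : y \in s -> 0 < y.1 by case/Ps.
pose L := \prod_(y <- s) y.1; exists L, (size s); split.
  by rewrite /L big_seq prodn_cond_gt0.
move=> n m lt_n hm.
have [k En lek] := heavy_decomposition us s_gt0 peel hm.
have [y sy Ly] : exists2 y, y \in s & L <= k y * y.1.
  apply/hasP; apply: contraLR lt_n => /hasPn small.
  rewrite -leqNgt En -sum1_size big_distrl big_seq [leqRHS]big_seq.
  by apply: leq_sum => y /small /=; rewrite mul1n -ltnNge => /ltnW.
have y_gt0 := s_gt0 y sy.
(* The block is [q] copies of [y], and [e] copies of [y] are left. *)
pose q := L %/ y.1.
have qy : q * y.1 = L by rewrite divnK // /L (big_rem y) //= dvdn_mulr.
have [e Ek] : exists e, k y = q + e.
  by exists (k y - q); rewrite subnKC // -(leq_pmul2r y_gt0) qy.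
have le_bm : (y.2 *+ q <= m)%MM.
  apply/mnm_lepP => i; apply: leq_trans (lek i).
  by rewrite mulmnE (big_rem y) //= Ek; nia.
exists (y.2 *+ q)%MM; split=> // C VC.
  by rewrite wtMn -qy [leqRHS]mulnC leq_mul2l (proj2 (Ps y sy)) ?orbT.
have le_km : \sum_(z <- s) k z * wt C z.2 <= wt C m.
  rewrite (eq_bigr _ (fun z _ => big_distrr _ _ _)) exchange_big.
  by apply: leq_sum => i _; apply: lek.
have le_rest : \sum_(z <- s | z != y) k z * z.1
    <= \sum_(z <- s | z != y) k z * wt C z.2.
  rewrite big_seq_cond [leqRHS]big_seq_cond; apply: leq_sum => z /andP[sz _].
  by rewrite leq_mul2l (proj2 (Ps z sz)) ?orbT.
rewrite (bigD1_seq y sy us) /= in le_km.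
rewrite wtB // wtMn En (bigD1_seq y sy us) /= Ek.
have le_e : e * y.1 <= e * wt C y.2.
  by rewrite leq_mul2l (proj2 (Ps y sy)) ?orbT.
rewrite mulnDl qy (leq_trans _ (leq_sub2r _ le_km)) //.
by rewrite Ek mulnDl [q * _]mulnC -!addnA addKn addKn leq_add.
Qed.

(** Blocks of degree [L] can be removed while more than [r * L] remains; for
    [g = r.+1 * L] and degree at least [2 * g], this allows [r.+1] removals,
    and the removed blocks add up to one of degree exactly [g]. *)
Lemma heavy_split_multiple (d : nat) (V : {set 'I_d} -> Prop) :
  exists2 g : nat, 0 < g & forall n m, heavy V (g * n.+2) m ->
    exists b, [/\ (b <= m)%MM, heavy V g b & heavy V (g * n.+1) (m - b)%MM].
Proof.
have [L [r [L_gt0 peel]]] := heavy_split_block V.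
have peels j n m : (r + j) * L < n -> heavy V n m -> exists b,
    [/\ (b <= m)%MM, heavy V (j * L) b & heavy V (n - j * L) (m - b)%MM].
  elim: j n m => [|j IHj] n m lt_n hm.
    exists 0%MM; split=> [|//|]; first by apply/mnm_lepP=> i; rewrite mnm0E.
    by rewrite subm0 subn0.
  have [|b [le_bm hb hmb]] := peel n m _ hm; first nia.
  have [|c [le_cm hc hmc]] := IHj _ _ _ hmb; first nia.
  exists (b + c)%MM; split.
  - apply/mnm_lepP => i; move/mnm_lepP/(_ i): le_bm.
    by move/mnm_lepP/(_ i): le_cm; rewrite mnmBE mnmDE; lia.
  - by move=> C VC; rewrite wtD mulSn leq_add ?hb ?hc.
  - by rewrite mulSn subnDA -submDA.
exists (r.+1 * L); first by rewrite muln_gt0.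
move=> n m hm; have [|b [le_bm hb hmb]] := peels r.+1 _ _ _ hm; first nia.
exists b; split=> //.
by have -> : r.+1 * L * n.+1 = r.+1 * L * n.+2 - r.+1 * L by nia.
Qed.

(** Blocks of degree [g] are split off as long as the degree is at least
    [2 * g]; what then remains, of degree [g], is the last block. *)
Lemma heavy_veronese (d : nat) (V : {set 'I_d} -> Prop) :
  exists2 g : nat, 0 < g & forall n m, heavy V (g * n) m ->
    exists2 b : 'I_n -> 'X_{1..d}, forall i, heavy V g (b i) &
      (\sum_(i < n) b i <= m)%MM.
Proof.
have [g g_gt0 split2] := heavy_split_multiple V.
exists g => // -[|n] m hm.
  exists (fun=> 0%MM) => [[]//|].
  by rewrite big_ord0; apply/mnm_lepP => i; rewrite mnm0E.
elim: n m hm => [|n IHn] m hm.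
  exists (fun=> m) => [_|]; first by rewrite muln1 in hm.
  by rewrite big_ord1 lepm_refl.
have [b [le_bm hb hmb]] := split2 n m hm.
have [c hc le_cm] := IHn _ hmb.
exists (fun i => if unlift ord0 i is Some j then c j else b) => [i|].
  by case: unliftP.
rewrite big_ord_recl unlift_none.
rewrite (eq_bigr c) => [|j _]; last by rewrite liftK.
apply/mnm_lepP => i; move/mnm_lepP/(_ i): le_bm.
move/mnm_lepP/(_ i): le_cm; rewrite mnmBE mnmDE => le_ci le_bi.
by rewrite -(subnKC le_bi) leq_add2l.
Qed.

Local Open Scope ring_scope.
Local Notation "x %:F" := (FracField.tofrac x).

(** * Ideals, their powers, and contraction from a localization *)

Lemma ideal_sum (A : comNzRingType) (J : A -> Prop) (X : eqType) (r : seq X)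
    (F : X -> A) :
  is_ideal J -> (forall x, x \in r -> J (F x)) -> J (\sum_(x <- r) F x).
Proof.
case=> J0 JD _ JF; rewrite big_seq.
by apply: (big_ind J) => // x; apply: JF.
Qed.

Lemma ideal_gen_min (A : comNzRingType) (S J : A -> Prop) :
  is_ideal J -> subideal S J -> subideal (ideal_gen S) J.
Proof.
move=> idJ SJ x [k [c [s [_ Ss ->]]]]; apply: ideal_sum => // i _.
by case: idJ => _ _ JM; apply/JM/SJ.
Qed.

Lemma sub_ideal_gen (A : comNzRingType) (S : A -> Prop) :
  subideal S (ideal_gen S).
Proof.
move=> x Sx; exists 1%N, (fun=> 1), (fun=> x); split=> //.
by rewrite big_ord1 mul1r.
Qed.

Lemma ideal_gen_ideal (A : comNzRingType) (S : A -> Prop) :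
  is_ideal (ideal_gen S).
Proof.
split.
- by exists 0%N, (fun=> 0), (fun=> 0); split=> [||]; [|case|rewrite big_ord0].
- move=> x y [k [c [s [_ Ss ->]]]] [l [e [t [_ St ->]]]].
  exists (k + l)%N,
    (fun i => match split i with inl j => c j | inr j => e j end),
    (fun i => match split i with inl j => s j | inr j => t j end).
  split=> // [i|]; first by case: (split i).
  rewrite big_split_ord /=; congr (_ + _); apply: eq_bigr => i _.
    by rewrite (unsplitK (inl i)).
  by rewrite (unsplitK (inr i)).
- move=> a x [k [c [s [_ Ss ->]]]].
  exists k, (fun i => a * c i), s; split=> //.
  by rewrite mulr_sumr; apply: eq_bigr => i _; rewrite mulrA.
Qed.

Lemma ideal_colon (A : comNzRingType) (J : A -> Prop) (y : A) :
  is_ideal J -> is_ideal (fun x => J (x * y)).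
Proof.
case=> J0 JD JM; split=> [|x z Jx Jz|a x Jx]; first by rewrite mul0r.
  by rewrite mulrDl; apply: JD.
by rewrite -mulrA; apply: JM.
Qed.

Lemma ideal_pow_ideal (A : comNzRingType) (I : A -> Prop) (n : nat) :
  is_ideal (ideal_pow I n).
Proof. exact: ideal_gen_ideal. Qed.

Lemma ideal_pow_prod (A : comNzRingType) (I : A -> Prop) (n : nat)
    (y : 'I_n -> A) :
  (forall i, I (y i)) -> ideal_pow I n (\prod_(i < n) y i).
Proof. by move=> Iy; apply: sub_ideal_gen; exists y. Qed.

Lemma ideal_pow_min (A : comNzRingType) (I J : A -> Prop) (n : nat) :
    is_ideal J ->
    (forall y : 'I_n -> A, (forall i, I (y i)) -> J (\prod_(i < n) y i)) ->
  subideal (ideal_pow I n) J.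
Proof. by move=> idJ IJ; apply: ideal_gen_min => // x [y Iy ->]; apply: IJ. Qed.

(** Membership is linear in each factor, so by two uses of [ideal_pow_min] it
    is enough to multiply products of generators. *)
Lemma ideal_powM (A : comNzRingType) (I : A -> Prop) (a b : nat) (x y : A) :
  ideal_pow I a x -> ideal_pow I b y -> ideal_pow I (a + b) (x * y).
Proof.
have idab := ideal_pow_ideal I (a + b).
move=> Iax; move: x Iax y; apply: ideal_pow_min.
  split=> [y _|x z Ix Iz y Iy|c x Ix y Iy].
  - by rewrite mul0r; case: idab.
  - by rewrite mulrDl; case: idab => _ ID _; apply: ID; auto.
  - by rewrite -mulrA; case: idab => _ _ IM; apply/IM/Ix.
move=> u Iu; apply: ideal_pow_min.
  have := ideal_colon (\prod_i u i) idab.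
  by congr is_ideal; apply/funext => x; rewrite mulrC.
move=> v Iv; pose w i := match split i with inl j => u j | inr j => v j end.
suff -> : \prod_i u i * \prod_i v i = \prod_i w i.
  by apply: ideal_pow_prod => i; rewrite /w; case: (split i).
rewrite big_split_ord /w /=; congr (_ * _); apply: eq_bigr => i _.
  by rewrite (unsplitK (inl i)).
by rewrite (unsplitK (inr i)).
Qed.

Lemma ideal_pow0 (A : comNzRingType) (I : A -> Prop) (x : A) :
  ideal_pow I 0 x.
Proof.
have [_ _ IM] := ideal_pow_ideal I 0.
rewrite -[x]mulr1; apply: IM.
by have := @ideal_pow_prod A I 0 (fun=> 1); rewrite big_ord0; apply; case.
Qed.

Lemma ideal_pow1 (A : comNzRingType) (I : A -> Prop) (x : A) :
  I x -> ideal_pow I 1 x.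
Proof.
by move=> Ix; have := @ideal_pow_prod A I 1 (fun=> x); rewrite big_ord1; apply.
Qed.

Lemma ideal_pow_addl (A : comNzRingType) (I : A -> Prop) (a b : nat) :
  subideal (ideal_pow I (a + b)) (ideal_pow I a).
Proof.
apply: ideal_pow_min; first exact: ideal_pow_ideal.
move=> y Iy; rewrite big_split_ord /= mulrC.
by have [_ _ IM] := ideal_pow_ideal I a; apply/IM/ideal_pow_prod.
Qed.

(** Clearing denominators: the product of the denominators of a linear
    combination avoids the prime. *)
Lemma ideal_extP (A : idomainType) (P J : A -> Prop) (x : A) :
    is_prime_ideal P -> is_ideal J ->
  ideal_ext P J x%:F <-> exists2 s, ~ P s & J (s * x).
Proof.
move=> [[P0 _ _] P1 PM] [J0 JD JM].
have nz s : ~ P s -> s%:F != 0.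
  by rewrite tofrac_eq0; apply: contra_notN => /eqP->.
split=> [[k [c [y [Pc Jy Ex]]]]|[s Ps Jsx]]; last first.
  exists 1%N, (fun=> s%:F^-1), (fun=> (s * x)%:F).
  split=> [_|_|]; first by exists 1, s; rewrite tofrac1 mul1r.
    by exists (s * x).
  by rewrite big_ord1 tofracM mulKf ?nz.
suff [s Ps [w Jw Ew]] : exists2 s, ~ P s &
    exists2 w, J w & s%:F * x%:F = w%:F.
  exists s => //; suff -> : s * x = w by [].
  by apply/eqP; rewrite -tofrac_eq tofracM Ew.
rewrite {}Ex.
apply: (big_ind (fun z => exists2 s, ~ P s &
  exists2 w, J w & s%:F * z = w%:F)) => [|z t|i _].
- by exists 1 => //; exists 0; rewrite // mulr0 tofrac0.
- move=> [s Ps [w Jw Ew]] [s' Ps' [w' Jw' Ew']].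
  exists (s * s'); first by case/PM.
  exists (s' * w + s * w'); first by apply: JD; apply: JM.
  by rewrite tofracD !tofracM -Ew -Ew'; ring.
- have [a [s [Ps ->]]] := Pc i; have [w Jw ->] := Jy i.
  exists s => //; exists (a * w); first exact: JM.
  by rewrite tofracM mulrA [_ / _]mulrC mulVKf ?nz.
Qed.

(** * The order along a set of variables *)

(** The zero polynomial has no monomials and satisfies every bound, as its
    order is infinite. *)
Definition ord_ge (K : fieldType) (d : nat) (C : {set 'I_d}) (n : nat)
    (f : {mpoly K[d]}) : bool :=
  all (fun m => n <= wt C m)%N (msupp f).

Lemma ord_geP (K : fieldType) (d : nat) (C : {set 'I_d}) (n : nat)
    (f : {mpoly K[d]}) :
  reflect (forall m, m \in msupp f -> (n <= wt C m)%N) (ord_ge C n f).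
Proof. exact: allP. Qed.

Lemma ord_geX (K : fieldType) (d : nat) (C : {set 'I_d}) (n : nat)
    (m : 'X_{1..d}) :
  ord_ge C n ('X_[m] : {mpoly K[d]}) = (n <= wt C m)%N.
Proof. by rewrite /ord_ge msuppX /= andbT. Qed.

Lemma ord_ge_leq (K : fieldType) (d : nat) (C : {set 'I_d}) (a b : nat)
    (f : {mpoly K[d]}) :
  (a <= b)%N -> ord_ge C b f -> ord_ge C a f.
Proof.
by move=> le_ab /ord_geP fb; apply/ord_geP => m /fb; apply: leq_trans.
Qed.

Lemma ord_ge0 (K : fieldType) (d : nat) (C : {set 'I_d}) (f : {mpoly K[d]}) :
  ord_ge C 0 f.
Proof. exact/ord_geP. Qed.

Lemma ord_geM (K : fieldType) (d : nat) (C : {set 'I_d}) (a b : nat)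
    (f g : {mpoly K[d]}) :
  ord_ge C a f -> ord_ge C b g -> ord_ge C (a + b) (f * g).
Proof.
move=> /ord_geP fa /ord_geP gb; apply/ord_geP => m /msuppM_le.
by case/allpairsP=> -[m1 m2] /= [/fa fm1 /gb gm2 ->]; rewrite wtD leq_add.
Qed.

Lemma ord_ge_ideal (K : fieldType) (d : nat) (C : {set 'I_d}) (n : nat) :
  is_ideal (fun f : {mpoly K[d]} => ord_ge C n f).
Proof.
split=> [|f g /ord_geP fn /ord_geP gn|a f fn].
- by rewrite /ord_ge msupp0.
- apply/ord_geP => m /msuppD_le; rewrite mem_cat.
  by case/orP; [apply: fn | apply: gn].
- by rewrite -[n]add0n ord_geM ?ord_ge0.
Qed.

Lemma ord_geB (K : fieldType) (d : nat) (C : {set 'I_d}) (n : nat)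
    (f g : {mpoly K[d]}) :
  ord_ge C n f -> ord_ge C n g -> ord_ge C n (f - g).
Proof.
have [_ ID IM] := ord_ge_ideal K C n.
by move=> fn gn; apply: ID => //; rewrite -mulN1r; apply: IM.
Qed.

Lemma ord_ge_prod (K : fieldType) (d : nat) (C : {set 'I_d}) (a n : nat)
    (y : 'I_n -> {mpoly K[d]}) :
  (forall i, ord_ge C a (y i)) -> ord_ge C (a * n) (\prod_(i < n) y i).
Proof.
elim: n y => [|n IHn] y ya; first by rewrite muln0 ord_ge0.
by rewrite mulnS big_ord_recl ord_geM ?IHn.
Qed.

Lemma ord_ge_pow (K : fieldType) (d : nat) (C : {set 'I_d}) (a n : nat)
    (J : {mpoly K[d]} -> Prop) :
    (forall f, J f -> ord_ge C a f) ->
  forall f, ideal_pow J n f -> ord_ge C (a * n) f.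
Proof.
move=> Ja; apply: ideal_pow_min; first exact: ord_ge_ideal.
by move=> y Jy; apply: ord_ge_prod => i; apply: Ja.
Qed.

Definition has_ord (K : fieldType) (d : nat) (C : {set 'I_d}) (n : nat)
    (f : {mpoly K[d]}) : bool :=
  ord_ge C n f && ~~ ord_ge C n.+1 f.

Lemma has_ord_exists (K : fieldType) (d : nat) (C : {set 'I_d})
    (f : {mpoly K[d]}) :
  f != 0 -> exists n, has_ord C n f.
Proof.
move=> f_nz; case Ef: (msupp f) => [|m s].
  by rewrite -msupp_eq0 Ef in f_nz.
have ex : exists n, ~~ ord_ge C n f.
  exists (wt C m).+1; apply/negP => /ord_geP/(_ m).
  by rewrite Ef mem_head ltnn => /(_ isT).
case: (ex_minnP ex) => -[|n]; first by rewrite ord_ge0.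
move=> fn minn; exists n; rewrite /has_ord fn andbT.
by apply: contraT => /minn; rewrite ltnn.
Qed.

Lemma leq_has_ord (K : fieldType) (d : nat) (C : {set 'I_d}) (a n : nat)
    (f : {mpoly K[d]}) :
  has_ord C n f -> ord_ge C a f = (a <= n)%N.
Proof.
case/andP=> fn nfn; apply/idP/idP => [fa|le_an]; last exact: ord_ge_leq fn.
by rewrite leqNgt; apply: contra nfn => lt_na; apply: ord_ge_leq fa.
Qed.

(** [f0] collects the monomials of minimal degree in the variables of [C]. *)
Lemma initial_form (K : fieldType) (d : nat) (C : {set 'I_d}) (n : nat)
    (f : {mpoly K[d]}) :
    has_ord C n f -> exists f0 : {mpoly K[d]},
  [/\ f0 != 0, forall m, m \in msupp f0 -> wt C m = n & ord_ge C n.+1 (f - f0)].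
Proof.
case/andP=> /ord_geP fn nfn.
pose f0 := \sum_(m <- msupp f | wt C m == n) f@_m *: 'X_[m].
have f0n m : m \in msupp f0 -> wt C m = n.
  move/msupp_sum_le/flatten_mapP => [k]; rewrite mem_filter => /andP[/eqP wk _].
  by move/msuppZ_le; rewrite msuppX inE => /eqP->.
have ff0 : ord_ge C n.+1 (f - f0).
  rewrite {1}[f]mpolyE (bigID (fun m => wt C m == n)) /= addrAC subrr add0r.
  rewrite -big_filter; apply: (ideal_sum (ord_ge_ideal K C _)) => m.
  rewrite mem_filter => /andP[wm fm].
  have [_ _ IM] := ord_ge_ideal K C n.+1.
  by rewrite -mul_mpolyC; apply: IM; rewrite ord_geX ltn_neqAle eq_sym wm fn.
exists f0; split=> //; apply: contraNneq nfn => f0_0.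
by rewrite -[f]subr0 -f0_0.
Qed.

(** The order is additive because the product of the initial forms is nonzero:
    it is concentrated in degree [a + b], and every other contribution to
    [f * g] has larger order. *)
Lemma has_ordM (K : fieldType) (d : nat) (C : {set 'I_d}) (a b : nat)
    (f g : {mpoly K[d]}) :
  has_ord C a f -> has_ord C b g -> has_ord C (a + b) (f * g).
Proof.
move=> fa gb; have [/andP[fa1 _] /andP[gb1 _]] := (fa, gb).
rewrite /has_ord ord_geM //=; apply/negP => fg.
have [f0 [f0_nz f0a ff0]] := initial_form fa.
have [g0 [g0_nz g0b gg0]] := initial_form gb.
have f0g0 : ord_ge C (a + b).+1 (f0 * g0).
  have -> : f0 * g0 = f * g - ((f - f0) * g + f0 * (g - g0)) by ring.
  apply: ord_geB => //.
  have [_ ID _] := ord_ge_ideal K C (a + b).+1.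
  apply: ID; first by rewrite -addSn ord_geM.
  by rewrite -addnS ord_geM //; apply/ord_geP => m /f0a->.
case Efg: (msupp (f0 * g0)) => [|m s].
  by have := mulf_neq0 f0_nz g0_nz; rewrite -msupp_eq0 Efg.
have m_fg : m \in msupp (f0 * g0) by rewrite Efg mem_head.
have := ord_geP _ _ _ f0g0 m m_fg.
move/msuppM_le/allpairsP: m_fg => [[m1 m2] /= [/f0a w1 /g0b w2 ->]].
by rewrite wtD w1 w2 ltnn.
Qed.

Lemma has_ordX (K : fieldType) (d : nat) (C : {set 'I_d}) (a n : nat)
    (f : {mpoly K[d]}) :
  has_ord C a f -> has_ord C (a * n) (f ^+ n).
Proof.
move=> fa; elim: n => [|n IHn]; last by rewrite exprS mulnS has_ordM.
by rewrite muln0 expr0 /has_ord ord_ge0 -mpolyX0 ord_geX wt0.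
Qed.

(** A factor [s] outside the prime generated by the variables of [C] has order
    0, so that multiplying by it does not change the order.  This is what lets
    the order be computed in the localization at that prime. *)
Lemma ord_ge_cancel (K : fieldType) (d : nat) (C : {set 'I_d}) (n : nat)
    (s f : {mpoly K[d]}) :
  ~~ ord_ge C 1 s -> ord_ge C n (s * f) -> ord_ge C n f.
Proof.
move=> s0; have {}s0 : has_ord C 0 s by rewrite /has_ord ord_ge0.
have [->|/(has_ord_exists C)[k fk]] := eqVneq f 0.
  by case: (ord_ge_ideal K C n).
by rewrite (leq_has_ord _ fk) (leq_has_ord _ (has_ordM s0 fk)).
Qed.

(** If the order [k] of [f] were less than [n], then in the integral equation
    of [f ^+ g], of degree [m], every term other than the leading one would have
    order larger than [k * g * m], the exact order of the leading one. *)
Lemma ord_ge_integral (K : fieldType) (d : nat) (C : {set 'I_d}) (n g : nat)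
    (J : {mpoly K[d]} -> Prop) (f : {mpoly K[d]}) :
    (0 < g)%N -> (forall h, J h -> ord_ge C g h) ->
  rational_power J n g f -> ord_ge C n f.
Proof.
move=> g_gt0 Jg [m [a [m_gt0 Ja Ef]]].
have [->|/(has_ord_exists C)[k fk]] := eqVneq f 0.
  by case: (ord_ge_ideal K C n).
rewrite (leq_has_ord _ fk) leqNgt; apply/negP => lt_kn.
have fgm := has_ordX m (has_ordX g fk).
case/andP: (fgm) => _ /negP; apply.
have -> : f ^+ g ^+ m = - \sum_(1 <= i < m.+1) a i * (f ^+ g) ^+ (m - i).
  by apply/eqP; rewrite -addr_eq0 Ef.
have idJ := ord_ge_ideal K C (k * g * m).+1.
rewrite -mulN1r; case: (idJ) => _ _ IM; apply: IM; apply: (ideal_sum idJ) => i.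
rewrite mem_index_iota => /andP[i_gt0 le_im].
have ai : ord_ge C (g * n * i) (a i).
  apply: ord_ge_pow (Ja i _); last by rewrite i_gt0.
  exact: ord_ge_pow.
have /andP[fi _] := has_ordX (m - i) (has_ordX g fk).
apply: ord_ge_leq (ord_geM ai fi).
have : (k.+1 * (g * i) <= n * (g * i))%N by rewrite leq_mul2r lt_kn orbT.
have : (0 < g * i)%N by rewrite muln_gt0 g_gt0.
rewrite -[in X in (_ * X < _)%N](subnKC (le_im : (i <= m)%N)).
by move: (m - i)%N => e; nia.
Qed.

(** * Covers, minimal primes and symbolic powers *)

Lemma wt_gt0P (d : nat) (C : {set 'I_d}) (m : 'X_{1..d}) :
  reflect (exists2 i, i \in C & 0 < m i)%N (0 < wt C m)%N.
Proof.
apply: (iffP idP) => [|[i Ci mi]].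
  rewrite lt0n sum_nat_eq0 negb_forall => /existsP[i].
  by rewrite negb_imply -lt0n => /andP[]; exists i.
by rewrite /wt (bigD1 i) //= addn_gt0 mi.
Qed.

Lemma wtU (d : nat) (C : {set 'I_d}) (i : 'I_d) :
  wt C U_(i)%MM = (i \in C).
Proof.
have [iC|iC] := boolP (i \in C).
  rewrite /wt (bigD1 i) //= mnm1E eqxx big1 ?addn0 // => j /andP[_ ji].
  by rewrite mnm1E eq_sym (negPf ji).
by apply: big1 => j jC; rewrite mnm1E; case: eqP iC jC => // -> /negPf->.
Qed.

Lemma mpolyX_split (K : fieldType) (d : nat) (m : 'X_{1..d}) (i : 'I_d) :
  (0 < m i)%N -> 'X_[m] = 'X_[m - U_(i)] * 'X_i :> {mpoly K[d]}.
Proof.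
move=> mi; rewrite -mpolyXD submK //; apply/mnm_lepP => j.
by rewrite mnm1E; case: eqP => [<-|].
Qed.

Lemma prime_ideal_monomial (K : fieldType) (d : nat)
    (P : {mpoly K[d]} -> Prop) (m : 'X_{1..d}) :
  is_prime_ideal P -> P 'X_[m] -> exists2 i, (0 < m i)%N & P 'X_i.
Proof.
move=> [_ P1 PM]; apply: contraPP => noP; rewrite mpolyXE_id.
apply: (big_ind (fun f => ~ P f)) => // [f g Pf Pg /PM[]//|i _].
have [->|mi] := posnP (m i); first by rewrite expr0.
elim: (m i) => [|k IHk]; first by rewrite expr0.
by rewrite exprS => /PM[PX|//]; apply: noP; exists i.
Qed.

Definition vars_in (K : fieldType) (d : nat) (P : {mpoly K[d]} -> Prop) :
    {set 'I_d} :=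
  [set i | `[< P 'X_i >]].

Lemma in_vars_in (K : fieldType) (d : nat) (P : {mpoly K[d]} -> Prop)
    (i : 'I_d) :
  reflect (P 'X_i) (i \in vars_in P).
Proof. by rewrite inE; apply: asboolP. Qed.

Lemma vars_ideal_sub (K : fieldType) (d : nat) (P : {mpoly K[d]} -> Prop)
    (C : {set 'I_d}) (f : {mpoly K[d]}) :
  is_ideal P -> C \subset vars_in P -> ord_ge C 1 f -> P f.
Proof.
move=> idP /subsetP CP /ord_geP f1; rewrite [f]mpolyE.
apply: (ideal_sum idP) => m /f1 /wt_gt0P[i /CP/in_vars_in Pi mi].
case: idP => _ _ PM; rewrite -mul_mpolyC (mpolyX_split K mi).
by apply/PM/PM.
Qed.

Lemma vars_ideal_prime (K : fieldType) (d : nat) (C : {set 'I_d}) :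
  is_prime_ideal (fun f : {mpoly K[d]} => ord_ge C 1 f).
Proof.
split; first exact: ord_ge_ideal.
  by rewrite -mpolyX0 ord_geX wt0.
move=> f g fg; have [f1|f1] := boolP (ord_ge C 1 f); first by left.
by right; apply: ord_ge_cancel f1 fg.
Qed.

Definition is_cover (d : nat) (S : 'X_{1..d} -> Prop) (C : {set 'I_d}) : Prop :=
  forall m, S m -> (0 < wt C m)%N.

Definition monomials_of (K : fieldType) (d : nat) (S : 'X_{1..d} -> Prop) :
    {mpoly K[d]} -> Prop :=
  fun h => exists2 m, S m & h = 'X_[m].

Arguments monomials_of K {d} S.

Lemma cover_ord_ge (K : fieldType) (d : nat) (S : 'X_{1..d} -> Prop)
    (C : {set 'I_d}) (f : {mpoly K[d]}) :
  is_cover S C -> ideal_gen (monomials_of K S) f -> ord_ge C 1 f.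
Proof.
move=> covC; apply: (ideal_gen_min (ord_ge_ideal K C 1)).
by move=> h [m /covC m1 ->]; rewrite ord_geX.
Qed.

Lemma prime_cover (K : fieldType) (d : nat) (S : 'X_{1..d} -> Prop)
    (P : {mpoly K[d]} -> Prop) :
    is_prime_ideal P -> subideal (ideal_gen (monomials_of K S)) P ->
  is_cover S (vars_in P).
Proof.
move=> prP IP m Sm; apply/wt_gt0P.
have [|i mi Pi] := @prime_ideal_monomial _ _ P m prP.
  by apply/IP/sub_ideal_gen; exists m.
by exists i => //; apply/in_vars_in.
Qed.

(** The variables in a prime between the two ideals form a cover inside [C],
    hence all of [C]. *)
Lemma minimal_cover_minimal_prime (K : fieldType) (d : nat)
    (S : 'X_{1..d} -> Prop) (C : {set 'I_d}) :
    minset (fun D => `[< is_cover S D >]) C ->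
  minimal_prime (ideal_gen (monomials_of K S)) (fun f => ord_ge C 1 f).
Proof.
case/minsetP=> /asboolP covC minC; split; first exact: vars_ideal_prime.
  by move=> f; apply: cover_ord_ge.
move=> Q prQ IQ QC f; have [idQ _ _] := prQ; apply: vars_ideal_sub => //.
rewrite (minC (vars_in Q)) //; first exact/asboolP/prime_cover.
apply/subsetP => i /in_vars_in/QC.
by rewrite ord_geX wtU; case: (i \in C).
Qed.

(** In the localization at a minimal prime [P], the ideal contains every
    variable ['X_i] of [P].  Removing [i] from the variables in [P] must break
    the cover property, otherwise [P] would not be minimal; so some generator
    involves no variable of [P] other than ['X_i].  As it is squarefree, it is
    ['X_i] times a monomial in variables outside [P]. *)
Lemma minimal_prime_variable (K : fieldType) (d : nat)
    (S : 'X_{1..d} -> Prop) (P : {mpoly K[d]} -> Prop) (i : 'I_d) :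
    (forall m, S m -> squarefree_monomial m) ->
    minimal_prime (ideal_gen (monomials_of K S)) P -> P 'X_i ->
  exists2 s, ~ P s & ideal_gen (monomials_of K S) (s * 'X_i).
Proof.
move=> sqfS [prP IP minP] Pi; have [idP _ _] := prP.
have [m Sm wm] : exists2 m, S m & wt (vars_in P :\ i) m = 0%N.
  apply: contrapT => noS.
  have cov : is_cover S (vars_in P :\ i).
    by move=> m Sm; rewrite lt0n; apply/eqP => wm; apply: noS; exists m.
  have : ord_ge (vars_in P :\ i) 1 ('X_i : {mpoly K[d]}).
    apply: (minP (fun f => ord_ge (vars_in P :\ i) 1 f)) => // [|f|f].
    - exact: vars_ideal_prime.
    - exact: cover_ord_ge.
    - by apply: vars_ideal_sub => //; apply: subD1set.
  by rewrite ord_geX wtU !inE eqxx.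
have [j Pj mj] := wt_gt0P _ _ (prime_cover prP IP Sm).
have wm0 k : k \in vars_in P :\ i -> m k = 0%N.
  move=> kC; move/eqP: wm; rewrite sum_nat_eq0 => /forall_inP/(_ k kC).
  by move/eqP.
have ji : j = i.
  by apply: contraTeq mj => ji; rewrite wm0 // in_setD1 ji.
rewrite {}ji {Pj} in mj; exists 'X_[m - U_(i)]; last first.
  by rewrite -mpolyX_split //; apply: sub_ideal_gen; exists m.
case/(prime_ideal_monomial prP) => k; rewrite mnmBE mnm1E.
have [<-|ik] := eqVneq i k.
  by have := sqfS m Sm i; case: (m i) mj => [|[]].
by rewrite subn0 => mk /in_vars_in Pk; rewrite wm0 ?in_setD1 1?eq_sym ?ik in mk.
Qed.

(** If all exponents are heavy and [P] is a minimal prime, then in the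
    localization each variable of [P] is in [I], so that a monomial of degree at
    least [n] in the variables of [P] is in the [n]-th power.  Conversely, every
    cover contains a minimal one, which gives a minimal prime; the order along
    it is at least [n] on the [n]-th power of [I] and is not changed by clearing
    a denominator. *)
Lemma symbolic_powerP (K : fieldType) (d : nat) (S : 'X_{1..d} -> Prop)
    (I : {mpoly K[d]} -> Prop) (n : nat) (f : {mpoly K[d]}) :
    (forall m, S m -> squarefree_monomial m) ->
    I = ideal_gen (monomials_of K S) ->
  symbolic_power I n f <-> forall m, m \in msupp f -> heavy (is_cover S) n m.
Proof.
move=> sqfS ->; set I0 := ideal_gen _.
split=> [fn m fm C covC|fn P minP]; last first.
  have [prP IP _] := minP; have [_ P1 PM] := prP.
  apply/ideal_extP => //; first exact: ideal_pow_ideal.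
  (* [h] belongs to the [k]-th power of [I] in the localization at [P]. *)
  pose loc k h := exists2 s, ~ P s & ideal_pow I0 k (s * h).
  have locM k l h h' : loc k h -> loc l h' -> loc (k + l)%N (h * h').
    move=> [s Ps Is] [t Pt It]; exists (s * t); first by case/PM.
    by rewrite mulrACA; apply: ideal_powM.
  have loc0 h : loc 0%N h by exists 1 => //; apply: ideal_pow0.
  have locX i k : loc (k * (i \in vars_in P))%N ('X_i ^+ k).
    elim: k => [|k IHk]; first exact: loc0.
    rewrite mulSn exprS; apply: locM => //; case: in_vars_in => [Pi|//].
    have [s Ps Is] := minimal_prime_variable sqfS minP Pi.
    by exists s => //; apply: ideal_pow1.
  have locm m : loc (wt (vars_in P) m) 'X_[m].
    rewrite mpolyXE_id /wt big_mkcond /=.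
    apply: (big_ind2 loc) => // [k h l h'|i _]; first exact: locM.
    have := locX i (m i).
    by case: (i \in _); rewrite ?muln1 ?muln0.
  have [_ ID IM] := ideal_pow_ideal I0 n.
  have covP := prime_cover prP IP.
  rewrite [f]mpolyE big_seq; apply: (big_ind (loc n)) => [|h h'|m fm].
  - by exists 1 => //; rewrite mulr0; case: (ideal_pow_ideal I0 n).
  - move=> [s Ps Is] [t Pt It]; exists (s * t); first by case/PM.
    rewrite mulrDr; apply: ID; last by rewrite -mulrA; apply: IM.
    by rewrite mulrAC [X in ideal_pow _ _ X]mulrC; apply: IM.
  - have [s Ps Is] := locm m; exists s => //.
    rewrite -mul_mpolyC mulrCA; apply: IM; move: Is.
    by rewrite -(subnKC (fn m fm _ covP)); apply: ideal_pow_addl.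
have [|C' minC sC'C] := @minset_exists _ (fun D => `[< is_cover S D >]) C.
  exact/asboolP.
have minP := minimal_cover_minimal_prime K minC.
have [prP _ _] := minP.
have /minsetP[/asboolP covC' _] := minC.
have [s /negP Ps] := (ideal_extP f prP (ideal_pow_ideal I0 n)).1 (fn _ minP).
move/(ord_ge_pow (fun h => @cover_ord_ge K d S C' h covC')).
rewrite mul1n => /(ord_ge_cancel Ps)/ord_geP/(_ m fm)/leq_trans; apply.
by rewrite /wt [leqRHS](big_setID C') (setIidPr sC'C) leq_addr.
Qed.

Lemma symbolic_power_ord_ge (K : fieldType) (d : nat) (S : 'X_{1..d} -> Prop)
    (I : {mpoly K[d]} -> Prop) (n : nat) (f : {mpoly K[d]}) :
    (forall m, S m -> squarefree_monomial m) ->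
    I = ideal_gen (monomials_of K S) ->
  symbolic_power I n f <-> forall C, is_cover S C -> ord_ge C n f.
Proof.
move=> sqfS EI; rewrite (symbolic_powerP _ _ sqfS EI).
split=> [fn C covC|fn m fm C covC]; last exact: ord_geP (fn C covC) m fm.
by apply/ord_geP => m fm; apply: fn.
Qed.

Theorem corollary3p4 (K : fieldType) (d : nat) (I : {mpoly K[d]} -> Prop)
    (hI : squarefree_monomial_ideal I) :
  exists2 g : nat, (0 < g)%N &
    forall (n : nat) (f : {mpoly K[d]}),
      symbolic_power I n f <-> rational_power (symbolic_power I g) n g f.
Proof.
have [S sqfS genI] := hI.
have EI : I = ideal_gen (monomials_of K S).
  by apply/funext => f; apply/propext/genI.
have [g g_gt0 veronese] := heavy_veronese (is_cover S).
exists g => // n f; split; last first.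
  move=> fn; apply/(symbolic_power_ord_ge _ _ sqfS EI) => C covC.
  apply: ord_ge_integral fn => // h.
  by move/(symbolic_power_ord_ge _ _ sqfS EI); apply.
move=> fn; pose J := ideal_pow (symbolic_power I g) n.
have idJ : is_ideal J by apply: ideal_pow_ideal.
(* An element [y] of an ideal satisfies the integral equation [y - y = 0]. *)
suff Jfg : J (f ^+ g).
  exists 1%N, (fun=> - (f ^+ g)); split=> // [i|].
    rewrite -eqn_leq eq_sym => /eqP->; apply: ideal_pow1.
    by rewrite -mulN1r; case: idJ => _ _; apply.
  by rewrite big_nat1 subnn expr0 mulr1 expr1 subrr.
have fgn : symbolic_power I (g * n) (f ^+ g).
  apply/(symbolic_power_ord_ge _ _ sqfS EI) => C covC.
  have -> : f ^+ g = \prod_(i < g) f by rewrite prodr_const card_ord.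
  rewrite mulnC; apply: ord_ge_prod => _.
  by move/(symbolic_power_ord_ge _ _ sqfS EI): fn; apply.
rewrite [f ^+ g]mpolyE; apply: (ideal_sum idJ) => m.
move/(symbolic_powerP _ _ sqfS EI): fgn => /[apply] /veronese[b hb le_bm].
case: idJ => _ _ JM; rewrite -mul_mpolyC -(submK le_bm) mpolyXD.
apply/JM/JM; rewrite (big_morph _ (@mpolyXD _ _) (@mpolyX0 _ _)).
apply: ideal_pow_prod => i; apply/(symbolic_powerP _ _ sqfS EI) => k.
by rewrite msuppX inE => /eqP->.
Qed.
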